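(* For every rooted (order-theoretic) tree $T$, the following are equivalent: (a) $\mathcal R(T)$ is $\sigma$-compact. (b) $\mathcal R(T)$ is Menger. (c) $\mathcal R(T)$ is Lindelöf and there is no order embedding $\varphi\colon\omega^{<\omega}\to T$ such that for every $s\in\omega^{<\omega}$ there is a $t_s\in T$ with $t_s\geq\varphi(s)$ for which, for every $n\in\omega$, $\varphi(s^\frown n)$ is a successor of $t_s$. (d) $\mathcal R(T)$ is Lindelöf and does not contain a closed topological copy of the Baire space $\omega^\omega$. (e) $\mathcal R(T)$ is Lindelöf and, for every nonempty closed $X\subseteq\mathcal R(T)$, there is an $x\in X$ with an open neighborhood $V_x$ in $X$ which is compact. (f) $\mathcal R(T)$ is Lindelöf and there exists an ordinal $\gamma$ such that $\partial_K^\gamma(T)=\emptyset$. Moreover, if $T$ is a pruned tree, then the condition ''$\mathcal R(T)$ is Lindelöf'' in all the items where it occurs may be replaced by ''every node of $T$ has at most countably many successors''.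
   Context: An order-theoretic tree is a partially ordered set $(T,<)$ such that for every $t\in T$ the set $\{s\in T: s<t\}$ is well-ordered by $<$. It is rooted if it has a least element (the root). A successor of a node $t$ means an immediate successor of $t$ in the tree order. A ray of $T$ is a nonempty downward closed chain $R\subseteq T$ with no maximal element (it need not be a maximal chain). $T$ is pruned if every node of $T$ belongs to some ray of $T$. The ray space $\mathcal R(T)$ is the set of all rays of $T$, topologized as a subspace of $\mathcal P(T)\cong 2^T$ with the product topology; i.e. a subbasis is given by the sets $[t]=\{R\in\mathcal R(T): t\in R\}$ and $\mathcal R(T)\setminus[t]$, for $t\in T$. $\omega^{<\omega}$ is the set of finite sequences of natural numbers ordered by extension; $s^\frown n$ is $s$ extended by the term $n$. An order embedding is a map $\varphi$ with $s\le s'\iff\varphi(s)\le\varphi(s')$. For a subtree (downward closed subset) $S\subseteq T$, a node $t\in S$ is $S$-compactly trivial if every $s\in S$ with $s\geq t$ has only finitely many successors in $S$. Define recursively for ordinals $\alpha$: $\partial_K^0(T)=T$; $\partial_K^{\alpha+1}(T)$ is obtained from $\partial_K^\alpha(T)$ by removing all $\partial_K^\alpha(T)$-compactly trivial nodes; and $\partial_K^\beta(T)=\bigcap_{\alpha<\beta}\partial_K^\alpha(T)$ for limit $\beta$. A space $X$ is Menger if for every sequence $(\mathcal U_n:n\in\omega)$ of open covers of $X$ there are finite $\mathcal F_n\subseteq\mathcal U_n$ with $X=\bigcup_{n\in\omega}\bigcup\mathcal F_n$. $X$ is Lindelöf if every open cover has a countable subcover, and $\sigma$-compact if it is a countable union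 of compact subspaces. A closed topological copy of $\omega^\omega$ (product topology of discrete $\omega$) is a closed subspace homeomorphic to it. *)

(* Defs.v *)
From HB Require Import structures.
From mathcomp Require Import all_boot all_order.
From mathcomp Require Import all_classical topology wochoice.

Set Implicit Arguments.
Unset Strict Implicit.
Unset Printing Implicit Defensive.

Import Order.TTheory.
Local Open Scope classical_set_scope.
Local Open Scope order_scope.

Section Trees.
Context {d : Order.disp_t} (T : porderType d).
Implicit Types (s t u : T) (R S : set T).

Definition is_tree := forall t, wo_chain <=%O [pred s : T | s < t].

Definition rooted := exists r, forall t, r <= t.

Definition downward_closed S := forall s t, s <= t -> S t -> S s.

Definition is_ray R :=
  [/\ R !=set0,
      downward_closed R,
      forall s t, R s -> R t -> s >=< t
    & forall t, R t -> exists2 u, R u & t < u].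

Definition pruned := forall t, exists2 R, is_ray R & R t.

Definition successors t : set T :=
  [set u | t < u /\ ~ exists s, t < s < u].

Definition compactly_trivial S t :=
  S t /\ forall s, S s -> t <= s -> finite_set (S `&` successors s).

Definition derivK S : set T := S `\` compactly_trivial S.

(* Subsets of [T] are encoded as points of [2^T] by their indicator
   functions; the carrier [set_type] gets the subspace topology. *)
Definition rays : set (prod_topology (fun _ : T => bool)) :=
  [set f | is_ray [set t | f t]].

Definition ray_space : topologicalType := set_type rays.

Definition wide_embedding (phi : seq nat -> T) :=
  (forall p q, prefix p q <-> phi p <= phi q) /\
  (forall p, exists t, phi p <= t /\
     forall n, successors t (phi (rcons p n))).

End Trees.

Arguments is_tree {d} T.
Arguments rooted {d} T.
Arguments pruned {d} T.
Arguments ray_space {d} T.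

(* [well_order R] is about the reflexive relation; this is its strict part. *)
Definition strict {W : Type} (R : rel W) (b a : W) : Prop := ~~ R a b.

Definition is_zero {W : Type} (R : rel W) (a : W) :=
  forall b, ~ strict R b a.

Definition is_next {W : Type} (R : rel W) (b a : W) :=
  strict R b a /\ ~ exists c, strict R b c /\ strict R c a.

Definition is_limit {W : Type} (R : rel W) (a : W) :=
  ~ is_zero R a /\ ~ exists b, is_next R b a.

Lemma strict_wf (W : Type) (R : rel W) : well_order R -> well_founded (strict R).
Proof.
move=> wo a; apply: contrapT => nAa.
pose A : {pred W} := fun x => `[< ~ Acc (strict R) x >].
have neA : wochoice.nonempty A by exists a; apply/asboolP.
have [z [[/asboolP nz lbz] _]] := wo A neA.
apply: nz; split=> b /negP nRzb; apply: contrapT => nb.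
by apply: nRzb; apply: lbz; apply/asboolP.
Qed.

Lemma is_next_inj (W : Type) (R : rel W) (a b c : W) :
  well_order R -> is_next R b a -> is_next R c a -> b = c.
Proof.
move=> wo [ba nb] [ca nc].
have Rbc : R b c by apply/negPn/negP => cb; apply: nc; exists b.
have Rcb : R c b by apply/negPn/negP => bc; apply: nb; exists c.
have [z [_ uz]] : exists! z, minimum_of R (fun x => `[< x = b \/ x = c >]) z.
  by apply: wo; exists b; apply/asboolP; left.
have Rbb : R b b.
  have [w [[/asboolP -> lw] _]] := wo (fun x => `[< x = b >])
    (ex_intro _ b (introT (asboolP _) erefl)).
  by apply: lw; apply/asboolP.
have Rcc : R c c.
  have [w [[/asboolP -> lw] _]] := wo (fun x => `[< x = c >])
    (ex_intro _ c (introT (asboolP _) erefl)).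
  by apply: lw; apply/asboolP.
have <- : z = b by apply: uz; split; [apply/asboolP; left | move=> x /asboolP[] ->].
by apply: uz; split; [apply/asboolP; right | move=> x /asboolP[] ->].
Qed.

Section IteratedDerivative.
Context {d : Order.disp_t} (T : porderType d).
Context {W : Type} {R : rel W} (woR : well_order R).

(* Ordinals are represented as elements of a well-ordered type: [a : W] stands
   for the order type of its set of strict predecessors.  The second branch
   covers both limits and zero, the empty intersection being the full set. *)
Definition derivK_step (a : W) (D : forall b, strict R b a -> set T) : set T :=
  match pselect (exists b, is_next R b a) with
  | left h => derivK (D (projT1 (cid h)) (projT2 (cid h)).1)
  | right _ => [set t | forall b (ba : strict R b a), D b ba t]
  end.

Definition iter_derivK : W -> set T :=
  Fix (strict_wf woR) (fun _ => set T) derivK_step.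

Lemma iter_derivKE a :
  iter_derivK a = derivK_step (fun b (_ : strict R b a) => iter_derivK b).
Proof.
rewrite /iter_derivK Fix_eq // => {}a f g fg; congr derivK_step.
by apply: functional_extensionality_dep => b; apply/funext => ba; exact: fg.
Qed.

Lemma iter_derivK_zero a : is_zero R a -> iter_derivK a = setT.
Proof.
move=> a0; rewrite iter_derivKE /derivK_step; case: pselect => [h|_].
  by exfalso; case: h => b [ba _]; exact: a0 ba.
by apply/seteqP; split=> // t _ b ba; case: (a0 _ ba).
Qed.

Lemma iter_derivK_next b a :
  is_next R b a -> iter_derivK a = derivK (iter_derivK b).
Proof.
move=> ba; rewrite iter_derivKE /derivK_step; case: pselect => [h|[]].
  by case: (cid h) => c ca /=; rewrite (is_next_inj woR ca ba).
by exists b.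
Qed.

Lemma iter_derivK_limit a : is_limit R a ->
  iter_derivK a = \bigcap_(b in [set b | strict R b a]) iter_derivK b.
Proof.
by move=> [_ nb]; rewrite iter_derivKE /derivK_step; case: pselect.
Qed.

End IteratedDerivative.

Arguments iter_derivK {d} T {W R} woR a.

Section Covering.
Variable X : topologicalType.

Definition open_cover (U : set (set X)) :=
  (forall O, U O -> open O) /\ \bigcup_(O in U) O = setT.

Definition lindelof := forall U, open_cover U ->
  exists V, [/\ V `<=` U, countable V & \bigcup_(O in V) O = setT].

Definition menger := forall U : nat -> set (set X),
  (forall n, open_cover (U n)) ->
  exists F : nat -> set (set X),
    (forall n, F n `<=` U n /\ finite_set (F n)) /\
    \bigcup_n \bigcup_(O in F n) O = setT.

Definition sigma_compact := exists K : nat -> set X,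
  (forall n, compact (K n)) /\ \bigcup_n K n = setT.


End Covering.

Definition homeomorphic (X Y : topologicalType) :=
  exists (f : X -> Y) (g : Y -> X),
    [/\ continuous f, continuous g, cancel f g & cancel g f].

(* The topology of [nat] is the discrete one. *)
Definition baire_space : topologicalType := prod_topology (fun _ : nat => nat).

(* Main.v *)
Require Import Defs.
From mathcomp Require Import all_boot all_order.
From mathcomp Require Import all_classical topology wochoice.

Set Implicit Arguments.
Unset Strict Implicit.
Unset Printing Implicit Defensive.

Import Order.TTheory.
Local Open Scope classical_set_scope.
Local Open Scope order_scope.

(** Call a nonempty downward closed set [S] of nodes a kernel if no node is
    [S]-compactly trivial.  Every condition in the two lists is tied to the
    absence of kernels, and ordinals enter in only one place.

    - A kernel contains the image of a wide embedding: above each of its nodes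
      some node branches infinitely inside the kernel ([kernel_embedding]).  A
      wide embedding turns each sequence of naturals into a ray, and these rays
      form a closed copy of the Baire space ([branch_closed],
      [range_branch_baire]).  Such a copy excludes the Menger property by the
      diagonal argument ([menger_no_closed_baire]); it has no nonempty compact
      open subset, so it is also excluded by the local compactness condition.

    - Without kernels, the union [S] of the rays in a nonempty closed set [X]
      has an [S]-compactly trivial node [t].  Above [t] the set [S] branches
      finitely, so the members of [X] through [t] form a compact set
      ([closed_has_compact_open]).

    - Without kernels and with countable branching, the ray space is
      sigma-compact.  Let [S] be the set of nodes [t] for which the rays through
      [t] do not form a sigma-compact set.  It is downward closed, and if it is
      nonempty it has an [S]-compactly trivial node [t].  A ray through [t]
      either stays in [S], which is finitely branching above [t], or leaves [S]
      at a first node [u].  In the second case the ray lies in the [n]-th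
      compact set exhausting the rays through [u], for some [n], and [u] is
      either not an immediate successor or among the first [n] successors of its
      predecessor, for [n] large.  Fixing [n] bounds the branching, so the rays
      obtained are again a compact set, and the rays through [t] are the union
      of these sets, a contradiction ([sigma_cube_closed_cone]).  The sets
      exhausting the rays through different [u] need not be countably many: at a
      ray of [S] uncountably many [u] can lie just above, but they accumulate
      only at that ray.

    - A kernel survives every iterate of the derivative.  Conversely, along a
      well-order too long to inject into the sets of nodes, two iterates
      coincide, and the repeated value is a kernel unless it is empty
      ([derivK_vanishes]).

    The Lindelof property follows from the Menger property, and it is used only
    through the countability, at each node, of the successors lying on rays
    ([lindelof_countable_cones]).  In a pruned tree these are all successors, so
    countability of the successors can take its place.

    Compactness is handled in [2^T], in the form of closure under limits of
    finite approximations ([cube_closed]). *)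

(** * Finite agreement in product spaces and subspaces *)

(** The traces of the neighborhoods of [f] on finitely many coordinates form a
    filter converging to [f] coordinatewise, hence finer than [nbhs f]. *)
Lemma nbhs_prod_finite (I : eqType) (K : I -> topologicalType)
    (f : prod_topology K) (O : set (prod_topology K)) :
  nbhs f O -> exists l : seq I, forall g : prod_topology K,
    (forall i, i \in l -> g i = f i) -> O g.
Proof.
pose agree (l : seq I) : set (prod_topology K) :=
  [set g | forall i, i \in l -> g i = f i].
pose F := filter_from [set: seq I] agree.
have FF : Filter F.
  apply: filter_from_filter; first by exists [::].
  move=> k l _ _; exists (k ++ l) => // g gkl; split=> i il; apply: gkl;
    by rewrite mem_cat il ?orbT.
have Ff : F --> (f : prod_topology K).
  apply/cvg_sup => i A [_ [[B oB <-] /= Bf BA]].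
  exists [:: i] => // g gi; apply: BA => /=.
  by rewrite /proj (gi i) ?mem_head.
by move=> /Ff [l _ lO]; exists l => g; exact: lO.
Qed.

Lemma nbhs_prod_coord (I : eqType) (K : I -> topologicalType)
    (f : prod_topology K) (i : I) :
  nbhs (f i) [set f i] -> nbhs f [set g : prod_topology K | g i = f i].
Proof. exact: proj_continuous. Qed.

Lemma nbhs_prod_agree (I : eqType) (K : I -> topologicalType)
    (f : prod_topology K) (l : seq I) :
  (forall i, nbhs (f i) [set f i]) ->
  nbhs f [set g : prod_topology K | forall i, i \in l -> g i = f i].
Proof.
move=> fi; elim: l => [|i l IH]; first by apply: filterS filterT => g.
apply: filterS (filterI (nbhs_prod_coord (fi i)) IH) => g [gi gl] j.
by rewrite inE => /predU1P[->|/gl].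
Qed.

Lemma nbhs_subtype (X : topologicalType) (A : set X) (x : A) (B : set A) :
  nbhs x B <-> exists2 O, nbhs (set_val x) O & set_val @^-1` O `<=` B.
Proof.
split=> [[_ [[O oO <-] /= Ox OB]]|[O nO OB]].
  by exists O => //; exact: open_nbhs_nbhs.
by apply: filterS OB _; exact: (@initial_continuous A X set_val).
Qed.

Lemma compact_subtype (X : topologicalType) (A : set X) (K : set A) :
  compact (set_val @` K) -> compact K.
Proof.
move=> cK F PF FK.
have FK' : F (set_val @^-1` (set_val @` K)).
  by apply: filterS FK => x Kx; exists x.
have [_ [[x Kx <-] clx]] := cK (set_val @ F) _ FK'.
exists x; split=> // B C FB /nbhs_subtype[O Ox OC].
have FB' : F (set_val @^-1` (set_val @` B)).
  by apply: filterS FB => y By; exists y.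
have [_ [[y By <-] Oy]] := clx (set_val @` B) _ FB' Ox.
by exists y; split=> //; exact: OC.
Qed.

(** A nonempty open set leaves all but finitely many coordinates free, so some
    coordinate projection maps it onto the noncompact space of naturals. *)
Lemma baire_not_locally_compact (V : set baire_space) x :
  open V -> V x -> ~ compact V.
Proof.
move=> oV Vx cV.
have [l lV] := nbhs_prod_finite (open_nbhs_nbhs (conj oV Vx)).
pose n := (\max_(i <- l) i).+1.
have nl : n \notin l.
  apply/negP => nl.
  by have := leq_bigmax_seq (P := xpredT) (F := id) n nl isT; rewrite ltnn.
have : compact (proj n @` V).
  apply: continuous_compact => //; apply: continuous_subspaceT.
  exact: proj_continuous.
have -> : proj n @` V = [set: nat].
  apply/seteqP; split=> // m _; exists (fun i => if i == n then m else x i).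
    by apply: lV => i il; case: eqP => // ein; rewrite -ein il in nl.
  by rewrite /proj eqxx.
move=> /(_ \oo _ filterT)[m [_ /(_ [set k | (m < k)%N] [set m])]] [].
- by exists m.+1.
- exact: discrete_set1.
by move=> k [/= mk km]; rewrite km ltnn in mk.
Qed.

(** * Covering properties *)

(** Each point is covered by all large enough finite subfamilies of [U], and by
    compactness a single one is large enough for all points. *)
Lemma compact_finite_subcover (X : topologicalType) (K : set X)
    (U : set (set X)) :
  compact K -> (forall O, U O -> open O) -> K `<=` \bigcup_(O in U) O ->
  exists F, [/\ F `<=` U, finite_set F & K `<=` \bigcup_(O in F) O].
Proof.
move=> /compact_near_coveringP cK oU KU.
pose fin := [set F : set (set X) | F `<=` U /\ finite_set F].
pose G := filter_from fin (fun F => [set F' | fin F' /\ F `<=` F']).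
have GG : Filter G.
  apply: filter_from_filter; first by exists set0; split.
  move=> F F' [FU fF] [FU' fF']; exists (F `|` F').
    by split; [rewrite subUset | rewrite finite_setU].
  by move=> E [fE]; rewrite subUset => -[FE F'E]; split.
have [x Kx|F [FU fF] KF] := cK _ G (fun F x => (\bigcup_(O in F) O) x) GG.
  have [O UO Ox] := KU _ Kx.
  exists (O, [set F | fin F /\ [set O] `<=` F]) => /=.
    split; first by apply: open_nbhs_nbhs; split=> //; exact: oU.
    exists [set O] => //; split=> [_ ->//|]; exact: finite_set1.
  by move=> [y F] /= [Oy [_ OF]]; exists O => //; exact: OF.
by exists F; split=> //; exact: (KF F (conj (conj FU fF) (@subset_refl _ F))).
Qed.

Lemma sigma_compact_menger (X : topologicalType) :
  sigma_compact X -> menger X.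
Proof.
move=> [K [cK KT]] U Uc.
have /choice[F FP] : forall n, exists F : set (set X),
    [/\ F `<=` U n, finite_set F & K n `<=` \bigcup_(O in F) O].
  move=> n; have [oU UT] := Uc n.
  by apply: compact_finite_subcover => //; rewrite UT.
exists F; split=> [n|]; first by have [] := FP n.
apply/seteqP; split=> // x _; have : (\bigcup_n K n) x by rewrite KT.
by move=> [n _ Kx]; exists n => //; have [_ _] := FP n; apply.
Qed.

Lemma menger_lindelof (X : topologicalType) : menger X -> lindelof X.
Proof.
move=> mX U Uc; have [F [FU FT]] := mX (fun=> U) (fun=> Uc).
exists (\bigcup_n F n); split=> [O [n _]||].
- by have [FUn _] := FU n; exact: FUn.
- by apply: bigcup_countable => // n _; apply: finite_set_countable; have [] := FU n.
- apply/seteqP; split=> // x _; have : (\bigcup_n \bigcup_(O in F n) O) x by rewrite FT.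
  by move=> [n _ [O FO Ox]]; exists O => //; exists n.
Qed.

(** The [n]-th cover sorts the points of the copy by the [n]-th term of the
    sequence they code.  Finitely many members of it miss some value [m n], and
    the point coding [m] is then missed by all the finite selections. *)
Lemma menger_no_closed_baire (X : topologicalType) (A : set X) :
  menger X -> closed A -> ~ homeomorphic A baire_space.
Proof.
move=> mX cA [f [g [cf _ _ gK]]].
pose U n := [set O : set X | open O /\
  exists k, forall a : A, O (set_val a) -> f a n = k].
have [n|F [FU FT]] := mX U.
  split=> [O []//|]; apply/seteqP; split=> // x _.
  have [Ax|nAx] := pselect (A x); last first.
    exists (~` A) => //; split; first exact: closed_openC.
    by exists 0%N => a /(_ (set_valP a)).
  pose a : A := exist _ x (mem_set Ax).
  have : nbhs a [set b | f b n = f a n].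
    apply: (cf a [set y : baire_space | y n = f a n]).
    apply: (@nbhs_prod_coord nat (fun=> nat) (f a) n); exact: discrete_set1.
  move=> [_ [[O oO <-] /= Ox OB]]; exists O => //; split=> //.
  by exists (f a n) => b Ob; exact: OB.
have /choice[m mP] : forall n, exists m, forall O, F n O ->
    forall a : A, O (set_val a) -> f a n <> m.
  move=> n; have [FUn fF] := FU n.
  have /choice[k kP] : forall O : set X, exists k, F n O ->
      forall a : A, O (set_val a) -> f a n = k.
    move=> O; have [FO|nFO] := pselect (F n O); last by exists 0%N.
    by have [_ [k kP]] := FUn _ FO; exists k.
  have := infinite_setN0 (infinite_setD infinite_nat (finite_image k fF)).
  move=> [j [_ nj]]; exists j => O FO a Oa fj; apply: nj; exists O => //.
  by rewrite -fj; apply/esym/kP.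
have : (\bigcup_n \bigcup_(O in F n) O) (set_val (g (m : baire_space))).
  by rewrite FT.
by move=> [n _ [O FO /(mP _ _ FO)]]; rewrite gK.
Qed.

(** * Rays as points of the ray space *)

Section RaySpace.
Context {d : Order.disp_t} (T : porderType d).
Implicit Types (s t u v : T) (S : set T) (R : ray_space T).
Implicit Types (X Y K : set (ray_space T)).

Definition nodes R : set T := [set t | set_val R t].

Definition cone t : set (ray_space T) := [set R | nodes R t].

Lemma nodes_ray R : is_ray (nodes R).
Proof. exact: (set_valP R). Qed.

Lemma ray_of_nodes S : is_ray S -> exists R, nodes R = S.
Proof.
move=> Sray; pose f : prod_topology (fun _ : T => bool) := fun t => `[< S t >].
have fS : [set t | f t] = S by apply/seteqP; split=> t /asboolP.
have fray : @rays d T f by rewrite /rays /= fS.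
by exists (exist _ f (mem_set fray)).
Qed.

Lemma nodes_inj : injective nodes.
Proof.
move=> R R' RR'; apply: val_inj; apply/funext => t.
by move: RR'; rewrite predeqE => /(_ t)[h h']; apply/idP/idP; [exact: h|exact: h'].
Qed.

Lemma ray_down R s t : s <= t -> nodes R t -> nodes R s.
Proof. by have [_ down _ _] := nodes_ray R; exact: down. Qed.

Lemma ray_chain R s t : nodes R s -> nodes R t -> s >=< t.
Proof. by have [_ _ chain _] := nodes_ray R; exact: chain. Qed.

Lemma ray_unbounded R t : nodes R t -> exists2 u, nodes R u & t < u.
Proof. by have [_ _ _ ub] := nodes_ray R; exact: ub. Qed.

(** [S] belongs to the closure of [K] in [2^T]. *)
Definition limit_of K S := forall l : seq T,
  exists2 R, K R & forall t, t \in l -> (nodes R t <-> S t).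

(** [K] is closed not only in the ray space but in the whole of [2^T]. *)
Definition cube_closed K := forall S, limit_of K S ->
  exists2 R, K R & nodes R = S.

Lemma nbhs_agree R (l : seq T) :
  nbhs R [set R' | forall t, t \in l -> (nodes R' t <-> nodes R t)].
Proof.
have Rl := @nbhs_prod_agree T (fun=> bool) (set_val R) l
  (fun t => discrete_set1 (set_val R t)).
apply/nbhs_subtype; eexists; first exact: Rl.
by move=> R' /= Rl' t /Rl' Rt; rewrite /nodes /= Rt.
Qed.

Lemma nbhs_ray R X : nbhs R X -> exists l : seq T,
  forall R', (forall t, t \in l -> (nodes R' t <-> nodes R t)) -> X R'.
Proof.
move=> /nbhs_subtype[O /nbhs_prod_finite[l lO] OX]; exists l => R' Rl.
apply: OX; apply: lO => t tl; have [h h'] := Rl t tl.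
by apply/idP/idP; [exact: h|exact: h'].
Qed.

Lemma closed_limit X : closed X <-> forall R, limit_of X (nodes R) -> X R.
Proof.
split=> [cX R lR|cX R clR].
  apply: cX => B /nbhs_ray[l lB]; have [R' XR' Rl] := lR l.
  by exists R'; split=> //; exact: lB.
apply: cX => l; have [R' [XR' Rl]] := clR _ (nbhs_agree R l).
by exists R'.
Qed.

Lemma cone_open t : open (cone t).
Proof.
rewrite openE => R Rt; apply: filterS (nbhs_agree R [:: t]) => R' /= Rl.
by apply/(Rl t); rewrite ?mem_head.
Qed.

Lemma cone_closed t : closed (cone t).
Proof.
apply/closed_limit => R /(_ [:: t])[R' Rt' Rl].
by apply/(Rl t); rewrite ?mem_head.
Qed.

(** A limit of rays can fail to be a ray, for instance by having a greatest element,
    so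
    closedness in the ray space would not give compactness here. *)
Lemma cube_closed_compact K : cube_closed K -> compact K.
Proof.
move=> Kc; apply: compact_subtype.
have cube : compact [set: prod_topology (fun _ : T => bool)].
  have := @tychonoff T (fun=> bool) (fun=> setT).
  rewrite (_ : [set f | _] = setT); last by apply/seteqP; split.
  by apply=> t; exact: bool_compact.
apply: subclosed_compact cube (@subsetT _ _) => f clf.
have [l|R KR Rf] := Kc [set t | f t].
  have [_ [[R KR <-] Rl]] :=
    clf _ (@nbhs_prod_agree T (fun=> bool) f l (fun t => discrete_set1 (f t))).
  by exists R => // t tl; rewrite /nodes /= Rl.
exists R => //; apply/funext => t; move: Rf; rewrite predeqE => /(_ t)[h h'].
by apply/idP/idP; [exact: h|exact: h'].
Qed.

Lemma cube_closedI_cone K t : cube_closed K -> cube_closed (K `&` cone t).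
Proof.
move=> Kc S lS; have [l|R KR RS] := Kc S.
  by have [R [KR _] Rl] := lS l; exists R.
exists R => //; split=> //.
have [R' [_ Rt'] /(_ t (mem_head _ _)) Rl] := lS [:: t].
by rewrite /cone /= RS; apply/Rl.
Qed.

Lemma limit_of_cone K S t : limit_of K S -> S t -> limit_of (K `&` cone t) S.
Proof.
move=> lS St l; have [R KR Rl] := lS (t :: l); exists R.
  by split=> //; apply/(Rl t) => //; exact: mem_head.
by move=> s sl; apply: Rl; rewrite inE sl orbT.
Qed.

Lemma limit_of_down K S : limit_of K S -> downward_closed S.
Proof.
move=> lS s t st St; have [R _ Rl] := lS [:: s; t].
apply/(Rl s); rewrite ?inE ?eqxx //; apply: ray_down st _.
by apply/(Rl t); rewrite ?inE ?eqxx ?orbT.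
Qed.

Lemma limit_of_chain K S s t : limit_of K S -> S s -> S t -> s >=< t.
Proof.
move=> lS Ss St; have [R _ Rl] := lS [:: s; t].
by apply: (@ray_chain R); apply/Rl; rewrite ?inE ?eqxx ?orbT.
Qed.

End RaySpace.
Arguments cone {d T} t.

(** * Trees and their successors *)

Section Trees.
Context {d : Order.disp_t} (T : porderType d).
Implicit Types (s t u v : T) (S : set T) (R : ray_space T).

Lemma successor_le s t u : successors s t -> s < u -> t >=< u -> t <= u.
Proof.
move=> [st nst] su /comparable_leP[//|ut].
by case: nst; exists u; rewrite su ut.
Qed.

Lemma successor_unique s t u : successors s t -> successors s u -> t >=< u ->
  t = u.
Proof.
move=> st su tu; apply/le_anti/andP; split.
  by apply: successor_le st su.1 tu.
by apply: successor_le su st.1 _; rewrite comparable_sym.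
Qed.

Hypothesis treeT : is_tree T.

Lemma tree_comparable s t u : s <= u -> t <= u -> s >=< t.
Proof.
rewrite le_eqVlt => /predU1P[->|su]; first by rewrite comparable_sym; exact: le_comparable.
rewrite le_eqVlt => /predU1P[->|tu]; first exact/le_comparable/ltW.
by have := wo_chainW (@treeT u) su tu.
Qed.

Lemma chain_min S : S !=set0 -> (forall s t, S s -> S t -> s >=< t) ->
  exists2 m, S m & forall t, S t -> m <= t.
Proof.
move=> [a Sa] chainS.
have [[b [Sb ba]]|nb] := pselect (exists b, S b /\ b < a); last first.
  exists a => // t St; have /comparable_leP[//|ta] := chainS _ _ Sa St.
  by case: nb; exists t.
pose A : {pred T} := fun t => `[< S t /\ t < a >].
have sA : {subset A <= [pred s : T | s < a]} by move=> t /asboolP[].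
have neA : wochoice.nonempty A by exists b; apply/asboolP.
have [m [[/asboolP[Sm ma] mmin] _]] := treeT sA neA.
exists m => // t St; have /comparable_leP[//|tm] := chainS _ _ Sm St.
have tA : t \in A by apply/asboolP; split=> //; exact: lt_trans tm ma.
by have := le_lt_trans (mmin t tA) tm; rewrite ltxx.
Qed.

Lemma predecessor_unique s t u : successors s u -> successors t u -> s = t.
Proof.
move=> [su nsu] [tu ntu].
have /comparable_ltgtP[st|ts|//] := tree_comparable (ltW su) (ltW tu).
  by case: nsu; exists t; rewrite st tu.
by case: ntu; exists s; rewrite ts su.
Qed.

Lemma ray_successor R t : nodes R t -> exists2 u, successors t u & nodes R u.
Proof.
move=> Rt; have [v Rv tv] := ray_unbounded Rt.
have [||u [Ru tu] umin] := @chain_min [set u | nodes R u /\ t < u].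
- by exists v.
- by move=> s s' [Rs _] [Rs' _]; exact: ray_chain Rs Rs'.
exists u => //; split=> // -[s /andP[ts su]].
have : u <= s by apply: umin; split=> //; exact: ray_down (ltW su) Ru.
by move/le_gtF; rewrite su.
Qed.

(** * Kernels *)

Definition kernel S :=
  [/\ S !=set0, downward_closed S & forall t, ~ compactly_trivial S t].

Lemma kernel_branches S t : kernel S -> S t ->
  exists s, [/\ S s, t <= s & infinite_set (S `&` successors s)].
Proof.
move=> [_ _ Snt] St; apply: contrapT => nbr; apply: (Snt t); split=> // s Ss ts.
by apply: contrapT => fs; apply: nbr; exists s.
Qed.

Lemma infinite_enum (X : Type) (A : set X) : infinite_set A ->
  exists2 e : nat -> X, injective e & forall n, A (e n).
Proof.
move=> /infiniteP/card_leP[f]; pose g n := f (exist _ n (mem_set I)).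
exists (fun n => set_val (g n)) => [m n|n]; last exact: set_valP.
by move=> /val_inj gmn; case: (@inj _ _ _ f _ _ (mem_set I) (mem_set I) gmn).
Qed.

(** Above each node of the kernel sits an infinitely branching one; walking from
    a node to the [n]-th of these children at each term of a sequence gives the
    embedding. *)
Lemma kernel_embedding S : kernel S ->
  exists phi : seq nat -> T, wide_embedding phi.
Proof.
move=> kS; have [[r Sr] _ _] := kS.
(* e t enumerates children of a branching node s above t *)
have /choice[e eP] : forall t, exists e : nat -> T, S t ->
    injective e /\ exists s, [/\ S s, t <= s &
      forall n, S (e n) /\ successors s (e n)].
  move=> t; have [St|nSt] := pselect (S t); last by exists (fun=> t).
  have [s [Ss ts /infinite_enum[e einj eS]]] := kernel_branches kS St.
  by exists e => _; split=> //; exists s; split=> // n; exact: eS.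
pose walk := foldl e.
have eS t n : S t -> S (e t n).
  by move=> St; have [_ [s [_ _ /(_ n)[]]]] := eP t St.
have e_gt t n : S t -> t < e t n.
  by move=> St; have [_ [s [_ ts /(_ n)[_ [/(le_lt_trans ts)]]]]] := eP t St.
have walkS t p : S t -> S (walk t p).
  by elim: p t => //= n p IH t St; apply: IH; exact: eS.
have walk_ge t p : S t -> t <= walk t p.
  elim: p t => //= n p IH t St; apply: le_trans (IH _ (eS _ n St)).
  exact/ltW/e_gt.
exists (walk r); split=> [p q|p]; last first.
  have [_ [s [_ ps sP]]] := eP (walk r p) (walkS _ _ Sr).
  exists s; split=> // n; rewrite /walk foldl_rcons; exact: (sP n).2.
split=> [/prefixP[p' ->]|].
  by rewrite /walk foldl_cat; apply: walk_ge; exact: walkS.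
elim: p r Sr q => [|i p IH] t St q; first by rewrite prefix0s.
case: q => [|j q] /=.
  have := lt_le_trans (e_gt t i St) (walk_ge (e t i) p (eS _ i St)).
  by move=> /[swap] /le_gtF ->.
move=> pq; have [einj [s [_ _ sP]]] := eP t St.
have ij : i = j.
  apply: einj; apply: (successor_unique (sP i).2 (sP j).2).
  apply: (@tree_comparable _ _ (walk t (j :: q))).
    by apply: le_trans pq; apply: walk_ge; exact: eS.
  by apply: walk_ge; exact: eS.
by rewrite -ij eqxx; apply: (IH (e t i)); [exact: eS|rewrite {2}ij].
Qed.

End Trees.

(** * Wide embeddings and closed copies of the Baire space *)

Section Embedding.
Context {d : Order.disp_t} (T : porderType d).
Implicit Types (s t u v : T) (R : ray_space T) (p q : seq nat).
Hypothesis treeT : is_tree T.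
Variable phi : seq nat -> T.
Hypothesis wide : wide_embedding phi.

Let phi_le p q : prefix p q <-> phi p <= phi q. Proof. exact: wide.1. Qed.

Let phi_rcons p n : phi p < phi (rcons p n).
Proof.
have [t [pt /(_ n)[tn _]]] := wide.2 p; exact: le_lt_trans pt tn.
Qed.

Lemma prefix_mkseq (x : nat -> nat) m n : (m <= n)%N ->
  prefix (mkseq x m) (mkseq x n).
Proof.
move=> /subnKC <-; rewrite /mkseq iotaD map_cat; exact: prefix_prefix.
Qed.

Definition branch_set (x : nat -> nat) : set T :=
  [set t | exists n, t <= phi (mkseq x n)].

Lemma branch_set_ray x : is_ray (branch_set x).
Proof.
split.
- by exists (phi [::]); exists 0%N.
- by move=> s t st [n tn]; exists n; exact: le_trans st tn.
- move=> s t [m sm] [n tn]; apply: (tree_comparable treeT (u := phi (mkseq x (maxn m n)))).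
    by apply: le_trans sm _; apply/phi_le/prefix_mkseq; exact: leq_maxl.
  by apply: le_trans tn _; apply/phi_le/prefix_mkseq; exact: leq_maxr.
- move=> t [n tn]; exists (phi (mkseq x n.+1)); first by exists n.+1.
  by apply: le_lt_trans tn _; rewrite mkseqS; exact: phi_rcons.
Qed.

Definition branch (x : baire_space) : ray_space T :=
  sval (cid (ray_of_nodes (branch_set_ray x))).

Lemma branchP (x : baire_space) t :
  nodes (branch x) t <-> exists n, t <= phi (mkseq x n).
Proof. by rewrite /branch; case: cid => R /= ->. Qed.

Lemma branch_phi (x : baire_space) p :
  nodes (branch x) (phi p) <-> p = mkseq x (size p).
Proof.
split=> [/branchP[n /phi_le/prefixP[q pq]]|pE]; last first.
  by apply/branchP; exists (size p); rewrite -pE.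
have := congr1 (take (size p)) pq.
rewrite take_size_cat // /mkseq -map_take take_iota => pE.
have sn : (size p <= n)%N.
  by have := congr1 size pq; rewrite size_mkseq size_cat => ->; exact: leq_addr.
by rewrite -[LHS]pE (minn_idPl sn).
Qed.

Lemma branch_inj : injective branch.
Proof.
move=> x y xy; apply/funext => n.
have : nodes (branch y) (phi (mkseq x n.+1)).
  by rewrite -xy; apply/branch_phi; rewrite size_mkseq.
move=> /branch_phi; rewrite size_mkseq => /(congr1 (nth 0%N ^~ n)) /=.
by rewrite !nth_mkseq.
Qed.

(** A limit [R] of branches contains some [phi (rcons p n)] whenever it contains
    [phi p]: with the parent [t] of these nodes and some [u] above [t] in [R], a
    branch through [phi p] and [u] meets a child of [t] that is at most [u].
    This builds a sequence whose branch is [R]. *)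
Lemma branch_closed : closed (range branch).
Proof.
apply/closed_limit => R lR.
have agree (l : seq T) : exists x, forall t, t \in l ->
    (nodes (branch x) t <-> nodes R t).
  by have [_ [x _ <-] xl] := lR l; exists x.
have step p : exists n, nodes R (phi p) -> nodes R (phi (rcons p n)).
  have [Rp|nRp] := pselect (nodes R (phi p)); last by exists 0%N.
  have [t [pt tP]] := wide.2 p.
  (* a branch through phi p goes on to a successor of t, hence contains t *)
  have through x : nodes (branch x) (phi p) ->
      nodes (branch x) (phi (rcons p (x (size p)))).
    by move=> /branch_phi pE; apply/branch_phi; rewrite size_rcons mkseqS -pE.
  have Rt : nodes R t.
    have [x xl] := agree [:: phi p; t].
    apply/(xl t); first by rewrite !inE eqxx orbT.
    apply: ray_down (ltW (tP (x (size p))).1) (through _ _).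
    by apply/xl; rewrite ?inE ?eqxx.
  have [u Ru tu] := ray_unbounded Rt.
  have [x xl] := agree [:: phi p; u].
  exists (x (size p)) => _.
  have xp : nodes (branch x) (phi p) by apply/xl; rewrite ?inE ?eqxx.
  have xu : nodes (branch x) u by apply/xl; rewrite ?inE ?eqxx ?orbT.
  apply: ray_down Ru; apply: successor_le (tP _) tu _.
  exact: ray_chain (through _ xp) xu.
have /choice[h hP] := step.
pose p := fix p n := if n is m.+1 then rcons (p m) (h (p m)) else [::].
pose x : baire_space := fun n => h (p n).
have pE n : p n = mkseq x n by elim: n => //= n IH; rewrite mkseqS /x -IH.
have xR n : nodes R (phi (mkseq x n)).
  rewrite -pE; elim: n => [|n IH] /=; last exact: hP.
  have [y yl] := agree [:: phi [::]]; apply/(yl _ (mem_head _ _)).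
  exact/branch_phi.
exists x => //; apply: nodes_inj; apply/seteqP; split=> u.
  by move=> /branchP[n un]; exact: ray_down un (xR n).
move=> Ru; have [y yl] := agree [:: u].
have /branchP[m um] : nodes (branch y) u by apply/yl; rewrite ?mem_head.
apply/branchP; exists m.+1.
have [z zl] := agree [:: u; phi (mkseq x m.+1)].
have zu : nodes (branch z) u by apply/zl; rewrite ?inE ?eqxx.
have zx : nodes (branch z) (phi (mkseq x m.+1)).
  by apply/zl; rewrite ?inE ?eqxx ?orbT.
have /comparable_leP[//|xu] := ray_chain zu zx.
have /phi_le/size_prefix : phi (mkseq x m.+1) <= phi (mkseq y m).
  exact: le_trans (ltW xu) um.
by rewrite !size_mkseq ltnn.
Qed.

(** For the continuity of [branch], suppose that [t] misses the branch of [x]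
    but lies below some [phi q].  Any branch through [t] that agrees with [x]
    beyond the length of [q] would have [t] above [phi] of a longer sequence
    than [q]. *)
Lemma range_branch_baire : homeomorphic (range branch) baire_space.
Proof.
pose g (x : baire_space) : range branch :=
  exist _ (branch x) (mem_set (imageT branch x)).
have /choice[f fP] : forall a : range branch, exists x, branch x = set_val a.
  by move=> a; have [x _ xa] := set_valP a; exists x.
exists f, g; split.
- move=> a; have fa : Filter (f x @[x --> a]) by apply: fmap_filter; exact: nbhs_filter.
  apply/cvg_sup => n B [_ [[O oO <-] /= Oa OB]].
  apply/nbhs_subtype; exists (cone (phi (mkseq (f a) n.+1))).
    apply: open_nbhs_nbhs; split; first exact: cone_open.
    by rewrite -fP; apply/branch_phi; rewrite size_mkseq.
  move=> b /=; rewrite -fP => /branch_phi.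
  rewrite size_mkseq => /(congr1 (nth 0%N ^~ n)).
  rewrite !nth_mkseq // => fafb; apply: OB => /=.
  by move: Oa; rewrite /proj fafb.
- move=> x B /nbhs_subtype[O /nbhs_ray[l lO] OB].
  suff : nbhs x [set y | forall t, t \in l ->
      (nodes (branch y) t <-> nodes (branch x) t)].
    by apply: filterS => y yl; apply: OB; exact: lO.
  elim: l {lO} => [|t l IH]; first by apply: filterS filterT => y.
  suff tx : nbhs x [set y | nodes (branch y) t <-> nodes (branch x) t].
    by apply: filterS (filterI tx IH) => y [yt yl] s; rewrite inE => /predU1P[->|/yl].
  have cylinder n : nbhs x [set y : baire_space | mkseq y n = mkseq x n].
    have := @nbhs_prod_agree nat (fun=> nat) x (iota 0 n) (fun i => discrete_set1 (x i)).
    by apply: filterS => y yx; apply/eq_in_map => i /yx.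
  have [xt|nxt] := pselect (nodes (branch x) t).
    have /branchP[n tn] := xt; apply: filterS (cylinder n) => y yx.
    by split=> // _; apply/branchP; exists n; rewrite yx.
  have [[q tq]|nq] := pselect (exists q, t <= phi q); last first.
    apply: filterS filterT => y _; split=> // /branchP[n tn].
    by case: nq; exists (mkseq y n).
  (* a branch agreeing with x beyond the length of q cannot reach t below phi q *)
  apply: filterS (cylinder (size q).+1) => y yx; split=> // yt.
  have yphi : nodes (branch y) (phi (mkseq x (size q).+1)).
    by apply/branch_phi; rewrite size_mkseq yx.
  have /comparable_leP[txq|xt] := ray_chain yt yphi.
    by apply/branchP; exists (size q).+1.
  have /phi_le/size_prefix := ltW (lt_le_trans xt tq).
  by rewrite size_mkseq ltnn.
- by move=> a; apply: val_inj; rewrite /= fP.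
- by move=> x; apply: branch_inj; rewrite fP.
Qed.

End Embedding.

(** * Compactness from the absence of kernels *)

Section NoKernel.
Context {d : Order.disp_t} (T : porderType d).
Implicit Types (s t u v : T) (S : set T) (R : ray_space T).
Implicit Types (X K : set (ray_space T)).
Hypothesis treeT : is_tree T.
Hypothesis no_kernel : ~ exists S : set T, kernel S.

(** What a limit of rays can lose is being unbounded.  A greatest node [s] is
    ruled out by an approximation on [s] and the finitely many nodes that can
    follow it. *)
Lemma limit_of_finite_branching K (F : set T) t : limit_of K F -> F t ->
  (forall s, F s -> t <= s -> exists l : seq T, forall R u,
     K R -> nodes R s -> successors s u -> nodes R u -> u \in l) ->
  is_ray F.
Proof.
move=> lF Ft fin; split.
- by exists t.
- exact: limit_of_down lF.
- by move=> s u; exact: limit_of_chain lF.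
move=> s Fs; apply: contrapT => smax.
have ts : t <= s.
  have /comparable_leP[//|st] := limit_of_chain lF Ft Fs.
  by case: smax; exists t.
have [l lP] := fin s Fs ts; have [R KR Rl] := lF (s :: l).
have Rs : nodes R s by apply/Rl; rewrite ?mem_head.
have [u su Ru] := ray_successor treeT Rs.
apply: smax; exists u; last by have [] := su.
by apply/(Rl u) => //; rewrite inE (lP R u) ?orbT.
Qed.

Lemma exists_compactly_trivial S : downward_closed S -> S !=set0 ->
  exists t, compactly_trivial S t.
Proof.
move=> dS S0; apply: contrapT => nt; apply: no_kernel; exists S; split=> //.
by move=> t St; apply: nt; exists t.
Qed.

(** With [S] the union of the rays in [X], an [S]-compactly trivial node [t]
    works: the limits of rays in [X] through [t] are rays, since [S] branches
    finitely above [t], and they belong to [X], which is closed. *)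
Lemma closed_has_compact_open X : closed X -> X !=set0 ->
  exists (x : X) (V : set X), [/\ open V, V x & compact V].
Proof.
move=> cX [R0 XR0]; pose S := [set t | exists2 R, X R & nodes R t].
have dS : downward_closed S.
  by move=> s t st [R XR Rt]; exists R => //; exact: ray_down Rt.
have [t [[R XR Rt] fint]] : exists t, compactly_trivial S t.
  apply: exists_compactly_trivial => //.
  by have [[r R0r] _ _ _] := nodes_ray R0; exists r, R0.
exists (exist _ R (mem_set XR)), (set_val @^-1` cone t); split=> //.
  by exists (cone t) => //; exact: cone_open.
apply: compact_subtype.
rewrite (_ : _ @` _ = X `&` cone t); last first.
  apply/seteqP; split=> [_ [a at_ <-]|R' [XR' Rt']].
    by split=> //; exact: set_valP.
  by exists (exist _ R' (mem_set XR')).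
apply: cube_closed_compact => F lF.
have lFX : limit_of X F by move=> l; have [R' [XR' _] Rl] := lF l; exists R'.
have FS : F `<=` S.
  move=> s Fs; have [R' XR' /(_ s (mem_head _ _)) Rl] := lFX [:: s].
  by exists R' => //; exact/Rl.
have Ft : F t.
  by have [R' [_ Rt'] /(_ t (mem_head _ _)) Rl] := lF [:: t]; exact/Rl.
have [R' RF] : exists R', nodes R' = F.
  apply: ray_of_nodes; apply: limit_of_finite_branching lF Ft _ => s Fs ts.
  have /finite_seqP[l lE] := fint s (FS _ Fs) ts.
  exists l => R' u [XR' _] _ su Ru.
  by have : [set` l] u by rewrite -lE; split=> //; exists R'.
exists R' => //; split; last by rewrite /cone /= RF.
by move/closed_limit: cX; apply; rewrite RF.
Qed.

(** The sets are required to increase so that membership in the [n]-th one can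
    be arranged for all large [n]. *)
Definition sigma_cube_closed X := exists C : nat -> set (ray_space T),
  [/\ forall n, cube_closed (C n), forall n, C n `<=` C n.+1
    & \bigcup_n C n = X].

Lemma sigma_cube_closedI_cone X t :
  sigma_cube_closed X -> sigma_cube_closed (X `&` cone t).
Proof.
move=> [C [cC iC CX]]; exists (fun n => C n `&` cone t); split=> [n|n|].
- exact: cube_closedI_cone.
- by move=> R [CR tR]; split=> //; exact: iC.
- by rewrite -CX setI_bigcupl.
Qed.

Definition first_exit S (A : set T) u :=
  [/\ A u, ~ S u & forall v, A v -> v < u -> S v].

Lemma first_exit_unique S (A : set T) u v :
  (forall s t, A s -> A t -> s >=< t) ->
  first_exit S A u -> first_exit S A v -> u = v.
Proof.
move=> chA [Au nSu Su] [Av nSv Sv].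
have /comparable_ltgtP[uv|vu|//] := chA _ _ Au Av.
  by case: nSu; exact: Sv.
by case: nSv; exact: Su.
Qed.

Lemma exists_first_exit S (A : set T) :
  (forall s t, A s -> A t -> s >=< t) -> ~ A `<=` S ->
  exists u, first_exit S A u.
Proof.
move=> chA /existsNP[a /not_implyP[Aa nSa]].
have [||u [Au nSu] umin] := @chain_min _ _ treeT [set u | A u /\ ~ S u].
- by exists a.
- by move=> v w [Av _] [Aw _]; exact: chA.
exists u; split=> // v Av vu; apply: contrapT => nSv.
by have := umin v (conj Av nSv); move/le_gtF; rewrite vu.
Qed.

(** The [n]-th set consists of the rays through [t] that stay in [S] or leave it
    within bounds given by [n].  A limit of such rays that stays in [S] is a ray
    because only finitely many successors of a node of [S] above [t] are within
    these bounds or in [S].  A limit that leaves [S] at [u] is a limit of rays that leave [S] at the same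
    [u], and the [n]-th set chosen for [u] contains it. *)
Lemma sigma_cube_closed_cone S t :
  (forall s, countable [set u | successors s u /\ cone u !=set0]) ->
  downward_closed S -> compactly_trivial S t ->
  (forall u, ~ S u -> sigma_cube_closed (cone u)) ->
  sigma_cube_closed (cone t).
Proof.
move=> csucc dS [St fint] nS.
have /choice[C CP] : forall u, exists C : nat -> set (ray_space T), ~ S u ->
    [/\ forall n, cube_closed (C n), forall m n, (m <= n)%N -> C m `<=` C n
      & \bigcup_n C n = cone u].
  move=> u; have [Su|/nS[C [cC iC CT]]] := pselect (S u).
    by exists (fun=> set0).
  exists C => _; split=> // m n /subnKC <-; elim: (n - m)%N => [|k IH].
    by rewrite addn0.
  by rewrite addnS; apply: subset_trans IH (iC _).
have /choice[idx idxP] : forall s, exists f : T -> nat,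
    {in [set u | successors s u /\ cone u !=set0] &, injective f}.
  by move=> s; have /countable_injP := csucc s.
(* D n: on leaving S, a ray lands in the n-th compact set of its exit node,
   which is not beyond the n-th successor of its predecessor, if any *)
pose D n := [set R | nodes R t /\ forall u, first_exit S (nodes R) u -> C u n R /\
  forall s, successors s u -> (idx s u <= n)%N].
exists D; split=> [n F lF|n R [Rt DR]|].
- have chF := limit_of_chain lF; have dF := limit_of_down lF.
  have Ft : F t.
    by have [R' [Rt' _] /(_ t (mem_head _ _)) Rl] := lF [:: t]; exact/Rl.
  have [FS|nFS] := pselect (F `<=` S); last first.
    have [u uF] := exists_first_exit chF nFS; have [Fu nSu umin] := uF.
    have exu R : nodes R u -> first_exit S (nodes R) u.
      by move=> Ru; split=> // v Rv vu; apply: umin => //; exact: dF (ltW vu) Fu.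
    have [cC _ _] := CP u nSu.
    have lFu := limit_of_cone lF Fu.
    have [l|R CR RF] := cC n F.
      have [R [[_ DR] /exu/DR[CR _]] Rl] := lFu l; exists R => //.
    exists R => //; split; first by rewrite RF.
    rewrite RF => v /(first_exit_unique chF uF) <-; split=> //.
    by have [R' [[_ DR] /exu/DR[]]] := lFu [::].
  have [R RF] : exists R, nodes R = F.
    apply: ray_of_nodes; apply: limit_of_finite_branching lF Ft _ => s Fs ts.
    have /finite_seqP[l lE] := fint s (FS _ Fs) ts.
    have /finite_seqP[l' lE'] : finite_set
        [set u | (successors s u /\ cone u !=set0) /\ (idx s u <= n)%N].
      set A := [set u | _].
      have idx_inj : {in A &, injective (idx s)}.
        move=> v w /set_mem[Av _] /set_mem[Aw _].
        by apply: idxP; exact: mem_set.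
      rewrite -(eq_finite_set (inj_card_eq idx_inj)).
      by apply: sub_finite_set (finite_II n.+1) => _ [v [_ vn] <-].
    exists (l ++ l') => R u [_ DR] Rs su Ru; rewrite mem_cat.
    have [Su|nSu] := pselect (S u).
      have : [set` l] u by rewrite -lE.
      by move=> /= ->.
    have : [set` l'] u.
      rewrite -lE' /=; split; first by split=> //; exists R.
      have [] := DR u; last by move=> _; apply.
      split=> // v Rv vu; apply: dS (FS _ Fs).
      have /comparable_leP[//|sv] := ray_chain Rv Rs.
      by case: su => _ []; exists v; rewrite sv vu.
    by move=> /= ->; rewrite orbT.
  exists R => //; split; first by rewrite RF.
  by move=> u [Ru nSu _]; case: nSu; apply: FS; rewrite -RF.
- split=> // u uR; have [CR idxR] := DR u uR; split=> [|s /idxR/leqW//].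
  have [_ nSu _] := uR; have [_ iC _] := CP u nSu.
  exact: iC (leqnSn n) _ CR.
- apply/seteqP; split=> [R [n _ []]//|R Rt].
  have chR s v : nodes R s -> nodes R v -> s >=< v by exact: ray_chain.
  have [[u uR]|noex] := pselect (exists u, first_exit S (nodes R) u); last first.
    by exists 0%N => //; split=> // u uR; case: noex; exists u.
  have [Ru nSu _] := uR; have [_ iC CT] := CP u nSu.
  have [k _ CR] : (\bigcup_n C u n) R by rewrite CT.
  have [m mP] : exists m, forall s, successors s u -> (idx s u <= m)%N.
    have [[s su]|ns] := pselect (exists s, successors s u).
      by exists (idx s u) => s' /(predecessor_unique treeT su) ->.
    by exists 0%N => s su; case: ns; exists s.
  exists (maxn k m) => //; split=> // v /(first_exit_unique chR uR) <-.
  split; first exact: iC (leq_maxl _ _) _ CR.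
  by move=> s /mP sm; apply: leq_trans sm (leq_maxr _ _).
Qed.

(** The nodes whose rays do not form a countable union of [cube_closed] sets are
    downward closed; unless there are none, one of them is compactly trivial
    among them, against the previous lemma. *)
Lemma sigma_compact_no_kernel : rooted T ->
  (forall t, countable [set u | successors t u /\ cone u !=set0]) ->
  sigma_compact (ray_space T).
Proof.
move=> [r rmin] csucc.
suff [C [cC _ CT]] : sigma_cube_closed [set: ray_space T].
  by exists C; split=> // n; exact: cube_closed_compact.
apply: contrapT => nT.
pose S := [set t | ~ sigma_cube_closed (cone t)].
have coneS s t : s <= t -> cone s `&` cone t = cone t.
  move=> st; apply/seteqP; split=> [R []//|R Rt]; split=> //.
  exact: ray_down st Rt.
have dS : downward_closed S.
  move=> s t st St Cs; apply: St; rewrite -(coneS _ _ st).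
  exact: sigma_cube_closedI_cone.
have Sr : S r.
  rewrite /S /= (_ : cone r = setT) //; apply/seteqP; split=> // R _.
  by have [[t Rt] _ _ _] := nodes_ray R; exact: ray_down (rmin t) Rt.
have [|t triv] := exists_compactly_trivial dS; first by exists r.
have [St _] := triv; apply: St; apply: sigma_cube_closed_cone csucc dS triv _.
by move=> u /contrapT.
Qed.

End NoKernel.

(** * The iterated derivative *)

Section WellOrder.
Variables (W : Type) (R : rel W).
Hypothesis woR : well_order R.

Lemma well_order_refl a : R a a.
Proof.
pose P : {pred W} := fun x => `[< x = a >].
have [|z [[/asboolP -> zmin] _]] := woR (A := P).
  by exists a; apply/asboolP.
by apply: zmin; apply/asboolP.
Qed.

Lemma strict_trichotomy a b : [\/ strict R a b, a = b | strict R b a].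
Proof.
rewrite /strict; case Rba: (R b a); last exact: Or31.
case Rab: (R a b); last exact: Or33.
pose P : {pred W} := fun x => `[< x = a \/ x = b >].
have [|z [_ zuniq]] := woR (A := P).
  by exists a; apply/asboolP; left.
apply: Or32; have <- : z = a.
  apply: zuniq; split; first by apply/asboolP; left.
  by move=> x /asboolP[] -> //; exact: well_order_refl.
apply: zuniq; split; first by apply/asboolP; right.
by move=> x /asboolP[] -> //; exact: well_order_refl.
Qed.

Lemma exists_next a b : strict R a b -> exists c, is_next R a c.
Proof.
elim/(well_founded_ind (strict_wf woR)): b => b IH ab.
have [[c [ac cb]]|nc] := pselect (exists c, strict R a c /\ strict R c b).
  exact: IH cb ac.
by exists b.
Qed.

End WellOrder.

Lemma no_injection_powerset (X : Type) (f : set X -> X) : ~ injective f.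
Proof.
move=> finj; pose B := [set x | exists2 A : set X, f A = x & ~ A x].
have nB : ~ B (f B).
  by move=> /[dup] BfB [A /finj ->]; apply.
by apply: (nB); exists B.
Qed.

Section Derivative.
Context {d : Order.disp_t} (T : porderType d).
Implicit Types (S : set T).

Lemma derivK_subset S : derivK S `<=` S.
Proof. by move=> t []. Qed.

Lemma derivK_down S : downward_closed S -> downward_closed (derivK S).
Proof.
move=> dS s t st [St nt]; split; first exact: dS st St.
move=> [_ fs]; apply: nt; split=> // u Su tu; apply: fs => //.
exact: le_trans st tu.
Qed.

Section Iteration.
Context {W : Type} {R : rel W} (woR : well_order R).
Notation iter := (iter_derivK T woR).

Lemma iter_derivK_decreasing a b : strict R b a -> iter a `<=` iter b.
Proof.
elim/(well_founded_ind (strict_wf woR)): a b => a IH b ba.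
rewrite [X in X `<=` _]iter_derivKE /derivK_step.
case: pselect => [h|_]; last by move=> t; apply.
case: (cid h) => c [ca nca] /=; apply: subset_trans (@derivK_subset _) _.
have [bc|-> //|cb] := strict_trichotomy woR b c; first exact: IH.
by case: nca; exists b.
Qed.

Lemma iter_derivK_down a : downward_closed (iter a).
Proof.
elim/(well_founded_ind (strict_wf woR)): a => a IH.
rewrite iter_derivKE /derivK_step; case: pselect => [h|_].
  by case: (cid h) => c [ca _] /=; apply: derivK_down; exact: IH.
by move=> s t st ta b ba; exact: (IH b ba s t st (ta b ba)).
Qed.

Lemma kernel_iter_derivK S a : kernel S -> S `<=` iter a.
Proof.
move=> kS; elim/(well_founded_ind (strict_wf woR)): a => a IH.
rewrite iter_derivKE /derivK_step; case: pselect => [h|_]; last first.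
  by move=> t St b ba; exact: IH.
case: (cid h) => c [ca _] /= t St; split; first by move: t St; exact: IH.
move=> [_ fin]; have [s [Ss ts]] := kernel_branches kS St; apply.
apply: sub_finite_set (fin s (IH c ca _ Ss) ts).
by apply: setSI; exact: IH.
Qed.

End Iteration.

(** Sets of sets of nodes, well-ordered, are too many for the iterates indexed by
    them to be distinct.  Since the iterates decrease, a repetition forces two
    consecutive ones to agree, so that the derivative removes no node. *)
Lemma derivK_vanishes :
  ~ (exists S : set T, kernel S) <->
  exists (W : Type) (R : rel W) (woR : well_order R) (gamma : W),
    iter_derivK T woR gamma = set0.
Proof.
split=> [nk|[W [R [woR [g g0]]]] [S kS]]; last first.
  have [[t St] _ _] := kS.
  by have := kernel_iter_derivK woR g kS St; rewrite g0.
have [R woR] := well_ordering_principle (set (set T)).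
exists (set (set T)), R, woR.
have [a [b [ab ab_eq]]] : exists a b, strict R a b /\
    iter_derivK T woR a = iter_derivK T woR b.
  apply: contrapT => nab.
  apply: (@no_injection_powerset (set T) (iter_derivK T woR)) => a b ab_eq.
  have [ab|//|ba] := strict_trichotomy woR a b; case: nab.
    by exists a, b.
  by exists b, a.
have [c ac] := exists_next woR ab.
exists a; apply: contrapT => /eqP/set0P a0; apply: nk.
exists (iter_derivK T woR a); split=> //; first exact: iter_derivK_down.
move=> t triv; have [ta _] := triv.
have : iter_derivK T woR c t.
  have [cb|->|bc] := strict_trichotomy woR c b.
  - by apply: (iter_derivK_decreasing cb); rewrite -ab_eq.
  - by rewrite -ab_eq.
  - by case: ac => _ []; exists b.
by rewrite (iter_derivK_next T woR ac) => -[].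
Qed.

End Derivative.

(** * The equivalences *)

Section Equivalences.
Context {d : Order.disp_t} (T : porderType d).
Hypothesis treeT : is_tree T.

Lemma wide_embedding_baire (phi : seq nat -> T) : wide_embedding phi ->
  exists A : set (ray_space T), closed A /\ homeomorphic A baire_space.
Proof.
move=> wide; exists (range (branch treeT wide)); split.
  exact: branch_closed.
exact: range_branch_baire.
Qed.

Lemma no_embedding_no_kernel :
  ~ (exists phi : seq nat -> T, wide_embedding phi) ->
  ~ exists S : set T, kernel S.
Proof. by move=> ne [S /(kernel_embedding treeT)]. Qed.

(** The condition applied to a closed copy of the Baire space would give a
    compact open subset of the latter. *)
Lemma compact_open_no_embedding :
  (forall A : set (ray_space T), closed A -> A !=set0 ->
    exists (x : A) (V : set A), [/\ open V, V x & compact V]) ->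
  ~ exists phi : seq nat -> T, wide_embedding phi.
Proof.
move=> loc [phi /wide_embedding_baire[A [cA [f [g [cf cg fK gK]]]]]].
have [|x [V [oV Vx cV]]] := loc A cA.
  by exists (set_val (g (fun=> 0%N))); exact: set_valP.
have fVE : f @` V = g @^-1` V.
  apply/seteqP; split=> [_ [a Va <-] /=|y Vy]; first by rewrite fK.
  by exists (g y).
apply: (@baire_not_locally_compact (f @` V) (f x)).
- by rewrite fVE; apply: open_comp => // y _; exact: cg.
- by exists x.
- by apply: continuous_compact cV; exact: continuous_subspaceT.
Qed.

(** The cones of the successors of [t], with the complement of the cone of [t],
    form an open cover from which no nonempty cone can be dropped. *)
Lemma lindelof_countable_cones : lindelof (ray_space T) -> forall t : T,
  countable [set u | successors t u /\ cone u !=set0].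
Proof.
move=> L t; pose P := [set u | successors t u /\ cone u !=set0].
have cone_inj u v : P u -> P v -> forall R, nodes R u -> nodes R v -> u = v.
  by move=> [tu _] [tv _] R Ru Rv; apply: successor_unique tu tv (ray_chain Ru Rv).
have [|V [VU cV VT]] := L ((cone @` P) `|` [set ~` cone t]).
  split=> [_ [[u _ <-]|->]|]; first exact: cone_open.
    exact/closed_openC/cone_closed.
  apply/seteqP; split=> // R _; have [Rt|nRt] := pselect (nodes R t).
    have [u tu Ru] := ray_successor treeT Rt.
    by exists (cone u) => //; left; exists u => //; split=> //; exists R.
  by exists (~` cone t) => //; right.
have PV : cone @` P `<=` V.
  move=> _ [u Pu <-]; have [tu [R Ru]] := Pu.
  have [O VO OR] : (\bigcup_(O in V) O) R by rewrite VT.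
  have [[v Pv vO]|OE] := VU _ VO.
    by move: OR; rewrite -vO => Rv; rewrite (cone_inj _ _ Pu Pv R Ru Rv) vO.
  by move: OR; rewrite OE; case; exact: ray_down (ltW tu.1) Ru.
apply: sub_countable (sub_countable (subset_card_le PV) cV).
have inj : {in P &, injective (@cone _ T)}.
  move=> u v /set_mem Pu /set_mem Pv uv; have [_ [R Ru]] := Pu.
  by apply: (cone_inj _ _ Pu Pv R Ru); move: Ru; rewrite -/(cone u R) uv.
by rewrite (card_le_eqr (inj_card_eq inj)); exact: card_lexx.
Qed.

Lemma pruned_countable_successors : pruned T ->
  (forall t : T, countable [set u | successors t u /\ cone u !=set0]) ->
  forall t : T, countable (successors t).
Proof.
move=> prT cs t; apply: sub_countable (cs t); apply: subset_card_le => u tu.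
by split=> //; have [S /ray_of_nodes[R <-] Ru] := prT u; exists R.
Qed.

End Equivalences.

Theorem theorem6p6 (d : Order.disp_t) (T : porderType d) :
  is_tree T -> rooted T ->
  let sigma_compact_rays := sigma_compact (ray_space T) in
  let menger_rays := menger (ray_space T) in
  let lindelof_rays := lindelof (ray_space T) in
  let no_embedding := ~ exists phi : seq nat -> T, wide_embedding phi in
  let no_baire_copy := ~ exists A : set (ray_space T),
    closed A /\ homeomorphic A baire_space in
  let closed_compact_nbhd := forall A : set (ray_space T),
    closed A -> A !=set0 ->
    exists (x : A) (V : set A), [/\ open V, V x & compact V] in
  let derivative_vanishes :=
    exists (W : Type) (R : rel W) (woR : well_order R) (gamma : W),
      iter_derivK T woR gamma = set0 in
  let countable_successors := forall t : T, countable (successors t) in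
  [<-> sigma_compact_rays;
       menger_rays;
       lindelof_rays /\ no_embedding;
       lindelof_rays /\ no_baire_copy;
       lindelof_rays /\ closed_compact_nbhd;
       lindelof_rays /\ derivative_vanishes] /\
  (pruned T ->
   [<-> sigma_compact_rays;
        menger_rays;
        countable_successors /\ no_embedding;
        countable_successors /\ no_baire_copy;
        countable_successors /\ closed_compact_nbhd;
        countable_successors /\ derivative_vanishes]).
Proof.
move=> treeT rootT sc mr lr ne nb ccn dv cs.
pose cc := forall t : T, countable [set u | successors t u /\ cone u !=set0].
pose nk := ~ exists S : set T, kernel S.
have mr_nb : mr -> nb.
  by move=> m [A [cA hA]]; exact: menger_no_closed_baire m cA hA.
have nb_ne : nb -> ne.
  by move=> nbT [phi /(wide_embedding_baire treeT)].
have nk_sc : cc -> nk -> sc.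
  by move=> ccT nkT; exact: sigma_compact_no_kernel treeT nkT rootT ccT.
have ne_nk : ne -> nk by exact: no_embedding_no_kernel treeT.
have nk_ccn : nk -> ccn by move=> nkT A; exact: closed_has_compact_open.
have ccn_ne : ccn -> ne by exact: compact_open_no_embedding treeT.
have [nk_dv dv_nk] : nk <-> dv := derivK_vanishes T.
have lr_cc : lr -> cc by exact: lindelof_countable_cones treeT.
have cs_cc : cs -> cc.
  by move=> csT t; apply: sub_countable (csT t); apply: subset_card_le => u [].
have sc_mr : sc -> mr by exact: sigma_compact_menger.
have mr_lr : mr -> lr by exact: menger_lindelof.
split=> [|prT].
  tfae.
  - by [].
  - by move=> m; split; [exact: mr_lr|exact/nb_ne/mr_nb].
  - move=> [l n]; split=> //; apply/mr_nb/sc_mr/nk_sc; [exact: lr_cc|exact: ne_nk].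
  - by move=> [l n]; split=> //; exact/nk_ccn/ne_nk/nb_ne.
  - by move=> [l n]; split=> //; exact/nk_dv/ne_nk/ccn_ne.
  - by move=> [l n]; apply: nk_sc; [exact: lr_cc|exact: dv_nk].
have cc_cs : cc -> cs by exact: pruned_countable_successors.
tfae.
- by [].
- by move=> m; split; [exact/cc_cs/lr_cc/mr_lr|exact/nb_ne/mr_nb].
- move=> [l n]; split=> //; apply/mr_nb/sc_mr/nk_sc; [exact: cs_cc|exact: ne_nk].
- by move=> [l n]; split=> //; exact/nk_ccn/ne_nk/nb_ne.
- by move=> [l n]; split=> //; exact/nk_dv/ne_nk/ccn_ne.
- by move=> [l n]; apply: nk_sc; [exact: cs_cc|exact: dv_nk].
Qed.
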